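(* (Constructively, i.e. without using the Law of Excluded Middle.) Let $\mathscr{S}$ be any finite, linearly discrete, noncollinear set of points on the real plane $\mathbb{R}^{2}$. There exist distinct points $A,B$ in $\mathscr{S}$ such that the line $l=AB$ passes through only these two points of $\mathscr{S}$; that is, for any point $X$ of $\mathscr{S}$ that lies on $l$, either $X=A$ or $X=B$.
   Context: The setting is Bishop-style constructive mathematics: intuitionistic logic, with the Law of Excluded Middle not available; the result is to be proved constructively. Real numbers are constructed by Cauchy sequences. For a real number $\alpha$, $\alpha\neq 0$ is the affirmative condition that one can construct a positive integer $n$ with $1/n<|\alpha|$ (and $\alpha\neq\beta$ means $\alpha-\beta\neq 0$). Valid constructive facts: if $\neg(\alpha\neq 0)$ then $\alpha=0$; if $\neg(\alpha>0)$ then $\alpha\le 0$; if $\neg(\alpha<0)$ then $\alpha\ge 0$; if $\alpha<\beta$ then for any real $x$ either $x>\alpha$ or $x<\beta$; if $\alpha\neq\beta$ then for any real $x$ either $x\neq\alpha$ or $x\neq\beta$ (cotransitivity), and likewise for points of $\mathbb{R}^2$. Points $A,B\in\mathbb{R}^2$ are distinct, written $A\neq B$, if the distance between them is positive. A point $P$ lies on a line $l$, written $P\in l$, if the distance $\rho(P,l)$ from $P$ to $l$ is $0$; $P$ lies outside $l$, written $P\notin l$, if $\rho(P,l)>0$. For distinct points $Q,R$, $QR$ denotes the line through them. A set is finite if its elements may be listed, $\{a_1,\dots,a_n\}$ with $n\ge 1$, but not necessarily distinctly. A set of points $\mathscr{S}$ is linearly discrete if for any point $P$ in $\mathscr{S}$,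 and for any line $l$ connecting two distinct points of $\mathscr{S}$, either $P$ lies on $l$ or $P$ lies outside $l$. A set of points is noncollinear if it contains distinct points $P,Q,R$ such that $P$ lies outside the line $QR$. *)

(* Defs.v *)
From Stdlib Require Export ConstructiveCauchyReals ConstructiveCauchyRealsMult.
From Stdlib Require Import QArith Qabs Qpower Qround Qminmax Lqa Lia ZArith CRelationClasses.

(** The ambient logic is Rocq's own, without classical axioms.  Propositions
    with computational content ([<] on [CReal], disjunction, existence,
    membership in a set of points) live in [Set] or [Type]: [A + B] is a
    decision between [A] and [B], and [{x : T & P x}] supplies a witness. *)

(* [CReal_sqrt], below, is total: it is the square root of [max 0 x]. *)

Local Open Scope Q_scope.

Definition Qsqrt_arg (x : CReal) (n : Z) : Q := Qmax 0 (seq x (2 * (n - 2))).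

(* The largest multiple of [2 ^ (n - 2)] whose square is at most [Qsqrt_arg x n]. *)
Definition CReal_sqrt_seq (x : CReal) (n : Z) : Q :=
  inject_Z (Z.sqrt (Qfloor (Qsqrt_arg x n / (2 ^ (n - 2) * 2 ^ (n - 2))))) * 2 ^ (n - 2).

Definition CReal_sqrt_scale (x : CReal) : Z := Z.max 0 (scale x).

Lemma CReal_sqrt_seq_spec (x : CReal) (n : Z) :
  let s := CReal_sqrt_seq x n in
  0 <= s /\ s * s <= Qsqrt_arg x n
  /\ Qsqrt_arg x n < (s + 2 ^ (n - 2)) * (s + 2 ^ (n - 2)).
Proof.
  unfold CReal_sqrt_seq. cbv zeta.
  assert (Hu : 0 <= Qsqrt_arg x n) by apply Q.le_max_l.
  assert (Hb : 0 < 2 ^ (n - 2)) by (apply Qpower_0_lt; lra).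
  set (u := Qsqrt_arg x n) in *. set (b := 2 ^ (n - 2)) in *.
  assert (Hbb : 0 < b * b) by nra.
  set (v := u / (b * b)).
  assert (Huv : u == v * (b * b)) by (unfold v; field; lra).
  assert (Hv : 0 <= v) by (unfold v; apply Qle_shift_div_l; lra).
  assert (HN : (0 <= Qfloor v)%Z).
  { change 0%Z with (Qfloor 0). apply Qfloor_resp_le; exact Hv. }
  pose proof (Z.sqrt_spec _ HN) as [H1 H2].
  pose proof (Z.sqrt_nonneg (Qfloor v)) as H0.
  set (r := Z.sqrt (Qfloor v)) in *.
  pose proof (Qfloor_le v) as F1. pose proof (Qlt_floor v) as F2.
  assert (R0 : 0 <= inject_Z r) by (change 0 with (inject_Z 0); rewrite <- Zle_Qle; lia).
  assert (R1 : inject_Z r * inject_Z r <= inject_Z (Qfloor v)).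
  { rewrite <- inject_Z_mult, <- Zle_Qle. exact H1. }
  assert (R2 : inject_Z (Qfloor v + 1) <= (inject_Z r + 1) * (inject_Z r + 1)).
  { change 1 with (inject_Z 1). rewrite <- inject_Z_plus, <- inject_Z_mult, <- Zle_Qle. lia. }
  repeat split.
  - nra.
  - rewrite Huv.
    setoid_replace (inject_Z r * b * (inject_Z r * b))
      with (inject_Z r * inject_Z r * (b * b)) by ring.
    apply Qmult_le_compat_r; lra.
  - rewrite Huv.
    setoid_replace ((inject_Z r * b + b) * (inject_Z r * b + b))
      with ((inject_Z r + 1) * (inject_Z r + 1) * (b * b)) by ring.
    apply Qmult_lt_compat_r; lra.
Qed.

Lemma Qsquare_lt_reg (a b : Q) : 0 <= b -> a * a < b * b -> a < b.
Proof. intros Hb H. apply Qnot_le_lt. intro H'. nra. Qed.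

Lemma Qpower2_twice (k : Z) : 2 ^ (2 * k) == 2 ^ k * 2 ^ k.
Proof. replace (2 * k)%Z with (k + k)%Z by lia. apply Qpower_plus. lra. Qed.

Lemma Qpower2_mono (j k : Z) : (j <= k)%Z -> 2 ^ j <= 2 ^ k.
Proof. intros H. apply Qpower_le_compat_l; [exact H | lra]. Qed.

Lemma CReal_sqrt_seq_lt (x : CReal) (k n p : Z) :
  (n <= k)%Z -> (p <= k)%Z -> CReal_sqrt_seq x n - CReal_sqrt_seq x p < 2 ^ k.
Proof.
  intros Hn Hp.
  destruct (CReal_sqrt_seq_spec x n) as (A0 & A1 & A2).
  destruct (CReal_sqrt_seq_spec x p) as (B0 & B1 & B2).
  assert (C : Qsqrt_arg x n < Qsqrt_arg x p + 2 ^ (k - 2) * 2 ^ (k - 2)).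
  { unfold Qsqrt_arg.
    pose proof (cauchy x (2 * (k - 2))%Z (2 * (n - 2))%Z (2 * (p - 2))%Z
                  ltac:(lia) ltac:(lia)) as C.
    apply Qabs_Qlt_condition in C. rewrite Qpower2_twice in C.
    pose proof (Q.le_max_l 0 (seq x (2 * (p - 2)))).
    pose proof (Q.le_max_r 0 (seq x (2 * (p - 2)))).
    assert (0 < 2 ^ (k - 2)) by (apply Qpower_0_lt; lra).
    apply Q.max_lub_lt; nra. }
  pose proof (Qpower2_mono (p - 2) (k - 2) ltac:(lia)) as Hb.
  assert (Hb0 : 0 < 2 ^ (p - 2)) by (apply Qpower_0_lt; lra).
  assert (Hk : 2 ^ k == 4 * 2 ^ (k - 2)).
  { replace k with (2 + (k - 2))%Z at 1 by lia. rewrite Qpower_plus by lra. reflexivity. }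
  rewrite Hk.
  set (B := 2 ^ (k - 2)) in *. set (b := 2 ^ (p - 2)) in *.
  set (s := CReal_sqrt_seq x n) in *. set (t := CReal_sqrt_seq x p) in *.
  assert (s < t + 2 * B); [| lra].
  apply Qsquare_lt_reg; [lra |]. nra.
Qed.

Lemma CReal_sqrt_cauchy (x : CReal) : QCauchySeq (CReal_sqrt_seq x).
Proof.
  intros k n p Hn Hp. apply Qabs_Qlt_condition.
  pose proof (CReal_sqrt_seq_lt x k n p Hn Hp).
  pose proof (CReal_sqrt_seq_lt x k p n Hp Hn). lra.
Qed.

Lemma CReal_sqrt_bound (x : CReal) : QBound (CReal_sqrt_seq x) (CReal_sqrt_scale x).
Proof.
  intros k. destruct (CReal_sqrt_seq_spec x k) as (A0 & A1 & _).
  rewrite Qabs_pos by exact A0.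
  pose proof (bound x (2 * (k - 2))%Z) as B. apply Qabs_Qlt_condition in B.
  pose proof (Qpower2_mono (scale x) (CReal_sqrt_scale x)
                ltac:(unfold CReal_sqrt_scale; lia)) as C.
  pose proof (Qpower2_mono 0 (CReal_sqrt_scale x)
                ltac:(unfold CReal_sqrt_scale; lia)) as D.
  change (2 ^ 0) with 1 in D.
  apply Qsquare_lt_reg; [lra |].
  apply Qle_lt_trans with (1 := A1). unfold Qsqrt_arg.
  apply Q.max_lub_lt; nra.
Qed.

Definition CReal_sqrt (x : CReal) : CReal :=
  mkCReal (CReal_sqrt_seq x) (CReal_sqrt_scale x)
    (CReal_sqrt_cauchy x) (CReal_sqrt_bound x).

Lemma CReal_le_small (x y : CReal) :
  (forall p : Z, (p <= 0)%Z -> seq x p - seq y p <= 2 * 2 ^ p) -> (x <= y)%CReal.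
Proof.
  intros H Hlt. destruct (CRealLt_above _ _ Hlt) as [n Hn].
  specialize (H (Z.min n 0) ltac:(lia)). specialize (Hn (Z.min n 0) ltac:(lia)).
  pose proof (Qpower2_mono (Z.min n 0) n ltac:(lia)). lra.
Qed.

Lemma CReal_sqrt_spec (x : CReal) :
  (0 <= x)%CReal -> (0 <= CReal_sqrt x)%CReal /\ (CReal_sqrt x * CReal_sqrt x == x)%CReal.
Proof.
  intros Hx.
  assert (Hx' : forall p, - (2 * 2 ^ p) <= seq x p).
  { intros p. pose proof (proj2 (CRealLe_not_lt _ _) Hx p) as H. cbn in H. lra. }
  assert (Key : forall p, (p <= 0)%Z ->
    seq (CReal_sqrt x * CReal_sqrt x) p - seq x p <= 2 * 2 ^ p
    /\ seq x p - seq (CReal_sqrt x * CReal_sqrt x) p <= 2 * 2 ^ p).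
  { intros p Hp.
    change (seq (CReal_sqrt x * CReal_sqrt x) p)
      with (CReal_sqrt_seq x (p - CReal_sqrt_scale x - 1)%Z
            * CReal_sqrt_seq x (p - CReal_sqrt_scale x - 1)%Z).
    assert (Hc : (0 <= CReal_sqrt_scale x)%Z) by (unfold CReal_sqrt_scale; lia).
    pose proof (CReal_sqrt_bound x (p - CReal_sqrt_scale x - 1)%Z) as Hs.
    set (c := CReal_sqrt_scale x) in *. set (m := (p - c - 1)%Z) in *.
    destruct (CReal_sqrt_seq_spec x m) as (A0 & A1 & A2).
    rewrite Qabs_pos in Hs by exact A0.
    set (s := CReal_sqrt_seq x m) in *.
    pose proof (cauchy x p (2 * (m - 2))%Z p ltac:(lia) ltac:(lia)) as C.
    apply Qabs_Qlt_condition in C.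
    pose proof (Hx' p) as P.
    assert (U1 : seq x (2 * (m - 2)) <= Qsqrt_arg x m) by apply Q.le_max_r.
    assert (U2 : Qsqrt_arg x m <= seq x p + 2 * 2 ^ p).
    { unfold Qsqrt_arg. apply Q.max_lub; [lra |].
      assert (0 < 2 ^ p) by (apply Qpower_0_lt; lra). lra. }
    split; [lra |].
    assert (Hb : 0 < 2 ^ (m - 2)) by (apply Qpower_0_lt; lra).
    assert (E1 : 2 ^ c * 2 ^ (m - 2) * 8 == 2 ^ p).
    { change 8 with (2 ^ 3). rewrite <- !Qpower_plus by lra.
      replace (c + (m - 2) + 3)%Z with p by (unfold m; lia). reflexivity. }
    assert (E2 : 2 ^ (m - 2) * 8 <= 2 ^ p).
    { change 8 with (2 ^ 3). rewrite <- Qpower_plus by lra. apply Qpower2_mono. lia. }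
    assert (E3 : 2 ^ (m - 2) <= 1).
    { change 1 with (2 ^ 0). apply Qpower2_mono. lia. }
    nra. }
  split; [| split]; apply CReal_le_small; intros p Hp; try apply (Key p Hp).
  destruct (CReal_sqrt_seq_spec x p) as (A0 & _).
  assert (0 < 2 ^ p) by (apply Qpower_0_lt; lra). cbn. lra.
Qed.

Local Close Scope Q_scope.

Local Open Scope CReal_scope.

Record point : Set := mkPoint { px : CReal; py : CReal }.

Definition point_eq (A B : point) : Prop := px A == px B /\ py A == py B.

Definition dist (A B : point) : CReal :=
  CReal_sqrt ((px A - px B) * (px A - px B) + (py A - py B) * (py A - py B)).

Lemma CReal_square_nonneg (x : CReal) : 0 <= x * x.
Proof.
  intros H.
  assert (H0 : x == 0).
  { split; intros C.
    - apply CReal_opp_gt_lt_contravar in C. rewrite CReal_opp_0 in C.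
      apply (CRealLt_irrefl 0), CReal_lt_trans with (2 := H).
      setoid_replace (x * x) with (- x * - x) by ring.
      apply CReal_mult_lt_0_compat; exact C.
    - apply (CRealLt_irrefl 0), CReal_lt_trans with (2 := H).
      apply CReal_mult_lt_0_compat; exact C. }
  rewrite H0, CReal_mult_0_l in H. exact (CRealLt_irrefl 0 H).
Qed.

Lemma CReal_square_le_reg (a b : CReal) : 0 <= b -> a * a <= b * b -> a <= b.
Proof.
  intros Hb H C. apply H.
  apply CReal_le_lt_trans with (a * b).
  - apply CReal_mult_le_compat_r; [exact Hb | apply CRealLt_asym; exact C].
  - apply CReal_mult_lt_compat_l; [| exact C].
    apply CReal_le_lt_trans with b; assumption.
Qed.

Lemma dist_spec (A B : point) :
  0 <= dist A B /\
  dist A B * dist A B ==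
    (px A - px B) * (px A - px B) + (py A - py B) * (py A - py B).
Proof.
  apply CReal_sqrt_spec.
  rewrite <- (CReal_plus_0_l 0). apply CReal_plus_le_compat; apply CReal_square_nonneg.
Qed.

Definition distinct (A B : point) : Set := 0 < dist A B.

Definition pset := point -> Type.

Definition line (Q R : point) : pset := fun X =>
  { t : CReal | point_eq X (mkPoint (px Q + t * (px R - px Q))
                                    (py Q + t * (py R - py Q))) }.

(* [d] is the infimum of the distances from [P] to the points of [l]; as usual
   constructively, an infimum is a lower bound that is approached. *)
Definition distance_to (P : point) (l : pset) (d : CReal) : Type :=
  (forall X, l X -> d <= dist P X) *
  (forall e, 0 < e -> { X : point & (l X * (dist P X < d + e))%type }).

Lemma line_distance_exists (P Q R : point) :
  distinct Q R -> { d : CReal & distance_to P (line Q R) d }.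
Proof.
  intros HQR. unfold distinct in HQR.
  set (vx := px R - px Q). set (vy := py R - py Q).
  set (wx := px P - px Q). set (wy := py P - py Q).
  assert (HN : 0 < vx * vx + vy * vy).
  { setoid_replace (vx * vx + vy * vy) with (dist Q R * dist Q R).
    - apply CReal_mult_lt_0_compat; exact HQR.
    - rewrite (proj2 (dist_spec Q R)). unfold vx, vy. ring. }
  set (N := vx * vx + vy * vy) in *.
  set (t0 := (wx * vx + wy * vy) * CReal_inv N (inr HN)).
  assert (Ht0 : wx * vx + wy * vy - t0 * N == 0).
  { unfold t0. rewrite CReal_mult_assoc, CReal_inv_l. ring. }
  set (F := mkPoint (px Q + t0 * vx) (py Q + t0 * vy)).
  exists (dist P F). split.
  - intros X [t [Ex Ey]]. cbn [px py] in Ex, Ey. fold vx in Ex. fold vy in Ey.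
    apply CReal_square_le_reg; [apply dist_spec |].
    rewrite (proj2 (dist_spec P F)), (proj2 (dist_spec P X)), Ex, Ey.
    cbn [F px py].
    setoid_replace ((px P - (px Q + t * vx)) * (px P - (px Q + t * vx)) +
                    (py P - (py Q + t * vy)) * (py P - (py Q + t * vy)))
      with ((px P - (px Q + t0 * vx)) * (px P - (px Q + t0 * vx)) +
            (py P - (py Q + t0 * vy)) * (py P - (py Q + t0 * vy))
            + ((t - t0) * (t - t0) * N
               + (1 + 1) * (t0 - t) * (wx * vx + wy * vy - t0 * N)))
      by (unfold N, wx, wy; ring).
    rewrite Ht0.
    rewrite <- CReal_plus_0_r at 1.
    apply CReal_plus_le_compat_l.
    rewrite CReal_mult_0_r, CReal_plus_0_r.
    apply CReal_mult_le_0_compat; [apply CReal_square_nonneg | apply CRealLt_asym; exact HN].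
  - intros e He. exists F. split.
    + exists t0. split; apply CRealEq_refl.
    + rewrite <- CReal_plus_0_r at 1. apply CReal_plus_lt_compat_l. exact He.
Qed.

Definition lies_on (P : point) (l : pset) : Type := distance_to P l 0.

Definition lies_outside (P : point) (l : pset) : Type :=
  { d : CReal & (distance_to P l d * (0 < d))%type }.

(* Repetitions in the list [a 0, ..., a (n - 1)] are allowed. *)
Definition finite (S : pset) : Type :=
  { n : nat & { a : nat -> point &
    ((1 <= n)%nat *
     (forall X, iffT (S X) { i : nat | (i < n)%nat /\ point_eq X (a i) }))%type } }.

Definition linearly_discrete (S : pset) : Type :=
  forall P Q R, S P -> S Q -> S R -> distinct Q R ->
    (lies_on P (line Q R) + lies_outside P (line Q R))%type.

Definition noncollinear (S : pset) : Type :=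
  { P : point & { Q : point & { R : point &
    (S P * S Q * S R * distinct P Q * distinct P R * distinct Q R *
     lies_outside P (line Q R))%type } } }.

(* Main.v *)
Require Import Defs.
From Stdlib Require Import List Lia Ring Setoid.

(** Twice the signed area of a triangle [X Q R] decides incidence: it vanishes
    iff [X] is on [QR], and is nonzero iff [X] is outside.  If [A B C] is a
    noncollinear triple of the set, then for any [Q] of the set the area of
    [A B C] is the sum of three areas with vertex [Q], so two of the lines
    [QA], [QB], [QC] are transversal; deciding whether [P] is on both decides
    whether [P = Q].  Hence the search for an ordinary line among finitely many
    points is decidable, and only its failure has to be refuted.  A refutation
    may use finitely many order comparisons of reals, so Kelly's argument with
    a minimal distance applies there. *)

Local Open Scope CReal_scope.

Definition cross (X Q R : point) : CReal :=
  (px Q - px X) * (py R - py X) - (py Q - py X) * (px R - px X).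

(** Free of the square root in [dist], so that identities about it are polynomial and fall to
    [ring]. *)
Definition dist_sq (A B : point) : CReal :=
  (px A - px B) * (px A - px B) + (py A - py B) * (py A - py B).

(** * Order on the reals *)

Lemma CReal_le_0_sub (x y : CReal) : x <= y <-> 0 <= y - x.
Proof.
  split; intros H.
  - apply (CReal_plus_le_reg_r x).
    setoid_replace (y - x + x) with y by ring. rewrite CReal_plus_0_l. exact H.
  - apply (CReal_plus_le_reg_r (- x)).
    setoid_replace (x + - x) with 0 by ring. exact H.
Qed.

Lemma CReal_plus_nonneg (x y : CReal) : 0 <= x -> 0 <= y -> 0 <= x + y.
Proof.
  intros Hx Hy. rewrite <- (CReal_plus_0_l 0). apply CReal_plus_le_compat; assumption.
Qed.

Lemma CReal_pos_of_mult (x y : CReal) : 0 <= x -> 0 < x * y -> 0 < x.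
Proof.
  intros Hx H. destruct (CReal_mult_pos_appart_zero x y H) as [H'|H'].
  - exact H'.
  - destruct (Hx H').
Qed.

Lemma CReal_mult_neg_neg (x y : CReal) : x < 0 -> y < 0 -> 0 < x * y.
Proof.
  intros Hx Hy. setoid_replace (x * y) with (- x * - y) by ring.
  apply CReal_mult_lt_0_compat; apply CReal_neg_lt_pos; assumption.
Qed.

Lemma CReal_square_pos (x : CReal) : 0 # x -> 0 < x * x.
Proof.
  intros [H|H].
  - apply CReal_mult_lt_0_compat; exact H.
  - apply CReal_mult_neg_neg; exact H.
Qed.

(** Tightness of apartness, with [0 < x * x] as a single inequality for [x] apart from 0. To prove
    an equality one may thus assume apartness and look for a contradiction. *)
Lemma CReal_square_zero (x : CReal) : (0 < x * x -> False) -> x == 0.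
Proof.
  intros H; split; intros C; apply H, CReal_square_pos; [right | left]; exact C.
Qed.

(** Cotransitivity: compare [x] with the strict inequality between 0 and [x + y]. *)
Lemma CReal_square_plus_pos (x y : CReal) :
  0 < (x + y) * (x + y) -> (0 < x * x) + (0 < y * y).
Proof.
  intros H. destruct (CReal_mult_pos_appart_zero _ _ H) as [C|C].
  - destruct (linear_order_T 0 x (x + y) C) as [D|D].
    + left. apply CReal_square_pos. left; exact D.
    + right. apply CReal_square_pos. left.
      apply (CReal_plus_lt_reg_l x). rewrite CReal_plus_0_r. exact D.
  - destruct (linear_order_T (x + y) x 0 C) as [D|D].
    + right. apply CReal_square_pos. right.
      apply (CReal_plus_lt_reg_l x). rewrite CReal_plus_0_r. exact D.
    + left. apply CReal_square_pos. right; exact D.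
Qed.

(** Concluding [0 < x] outright would be Markov's principle; towards a contradiction it may be
    assumed. *)
Lemma CReal_nonneg_pos (x : CReal) : 0 <= x -> ~ x == 0 -> (0 < x -> False) -> False.
Proof. intros H0 Hn H. apply Hn. split; assumption. Qed.

Lemma CReal_sum_squares_zero (x y : CReal) : x * x + y * y == 0 -> x == 0 /\ y == 0.
Proof.
  intros H; split; apply CReal_square_zero; intros C.
  - apply (CRealLt_irrefl 0), CReal_lt_le_trans with (1 := C). rewrite <- H.
    rewrite <- (CReal_plus_0_r (x * x)) at 1.
    apply CReal_plus_le_compat_l, CReal_square_nonneg.
  - apply (CRealLt_irrefl 0), CReal_lt_le_trans with (1 := C). rewrite <- H.
    rewrite <- (CReal_plus_0_l (y * y)) at 1.
    apply CReal_plus_le_compat; [apply CReal_square_nonneg | apply CRealLe_refl].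
Qed.

(** * Incidence *)

Lemma point_eq_refl (A : point) : point_eq A A.
Proof. split; apply CRealEq_refl. Qed.

Lemma point_eq_sym (A B : point) : point_eq A B -> point_eq B A.
Proof. intros [Hx Hy]; split; apply CRealEq_sym; assumption. Qed.

Lemma point_eq_trans (A B C : point) : point_eq A B -> point_eq B C -> point_eq A C.
Proof. intros [Hx Hy] [Kx Ky]; split; eapply CRealEq_trans; eassumption. Qed.

Lemma dist_sq_nonneg (A B : point) : 0 <= dist_sq A B.
Proof. apply CReal_plus_nonneg; apply CReal_square_nonneg. Qed.

Lemma dist_sq_zero (A B : point) : dist_sq A B == 0 -> point_eq A B.
Proof.
  intros H. destruct (CReal_sum_squares_zero _ _ H) as [Hx Hy].
  split.
  - setoid_replace (px A) with (px A - px B + px B) by ring. rewrite Hx. ring.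
  - setoid_replace (py A) with (py A - py B + py B) by ring. rewrite Hy. ring.
Qed.

Lemma distinct_dist_sq (A B : point) : distinct A B -> 0 < dist_sq A B.
Proof.
  intros H. unfold dist_sq. rewrite <- (proj2 (dist_spec A B)).
  apply CReal_mult_lt_0_compat; exact H.
Qed.

Lemma dist_sq_distinct (A B : point) : 0 < dist_sq A B -> distinct A B.
Proof.
  intros H. unfold dist_sq in H. rewrite <- (proj2 (dist_spec A B)) in H.
  exact (CReal_pos_of_mult _ _ (proj1 (dist_spec A B)) H).
Qed.

Lemma distinct_not_eq (A B : point) : distinct A B -> ~ point_eq A B.
Proof.
  intros H [Ex Ey]. apply distinct_dist_sq in H. unfold dist_sq in H.
  rewrite Ex, Ey in H. apply (CRealLt_irrefl 0).
  eapply CRealLt_proper_r; [| exact H]. ring.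
Qed.

Lemma cross_ext (X Q R X' Q' R' : point) :
  point_eq X X' -> point_eq Q Q' -> point_eq R R' -> cross X Q R == cross X' Q' R'.
Proof.
  intros [Xx Xy] [Qx Qy] [Rx Ry]. unfold cross. rewrite Xx, Xy, Qx, Qy, Rx, Ry.
  apply CRealEq_refl.
Qed.

(* Lagrange's identity *)
Lemma cross_square_le (X Q R : point) :
  cross X Q R * cross X Q R <= dist_sq X Q * dist_sq X R.
Proof.
  apply CReal_le_0_sub. unfold cross, dist_sq.
  set (d := (px Q - px X) * (px R - px X) + (py Q - py X) * (py R - py X)).
  match goal with |- _ <= ?e => setoid_replace e with (d * d) by (unfold d; ring) end.
  apply CReal_square_nonneg.
Qed.

Lemma cross_pos_dist_sq (X Q R : point) :
  0 < cross X Q R * cross X Q R -> 0 < dist_sq X Q.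
Proof.
  intros H. apply (CReal_pos_of_mult _ (dist_sq X R) (dist_sq_nonneg _ _)).
  apply CReal_lt_le_trans with (1 := H), cross_square_le.
Qed.

(** Moving [Q] to [Y] along the line does not change the cross product with [R - Q]; then Lagrange's
    identity applies to [Y - X] and [R - Q]. *)
Lemma cross_square_le_line (X Q R Y : point) : line Q R Y ->
  cross X Q R * cross X Q R <= dist_sq X Y * dist_sq Q R.
Proof.
  intros [t [Ex Ey]]. cbn [px py] in Ex, Ey.
  apply CReal_le_0_sub. unfold dist_sq.
  set (d := (px Y - px X) * (px R - px Q) + (py Y - py X) * (py R - py Q)).
  match goal with |- _ <= ?e => setoid_replace e with (d * d) end.
  - apply CReal_square_nonneg.
  - unfold d, cross. rewrite Ex, Ey. ring.
Qed.

Lemma lies_on_cross (X Q R : point) :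
  distinct Q R -> lies_on X (line Q R) -> cross X Q R == 0.
Proof.
  intros HQR [_ Happ]. apply CReal_square_zero. intros Hc.
  pose proof (CReal_sqrt_spec _ (CReal_square_nonneg (cross X Q R))) as [C0 C1].
  set (C := CReal_sqrt (cross X Q R * cross X Q R)) in *.
  assert (HC : 0 < C).
  { apply (CReal_pos_of_mult C C C0). rewrite C1. exact Hc. }
  unfold distinct in HQR.
  (* With [C] the absolute value of the cross product, [e] is the height of [X] over [QR]; no point
     [Y] of the line can be nearer to [X] than that. *)
  set (e := C * CReal_inv (dist Q R) (inr HQR)).
  assert (He : e * dist Q R == C).
  { unfold e. rewrite CReal_mult_assoc, CReal_inv_l. ring. }
  assert (He0 : 0 < e).
  { apply CReal_mult_lt_0_compat; [exact HC |].
    apply CReal_inv_0_lt_compat. exact HQR. }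
  destruct (Happ e He0) as [Y [HY Hd]].
  rewrite CReal_plus_0_l in Hd.
  apply (cross_square_le_line X Q R Y HY).
  unfold dist_sq. rewrite <- !(proj2 (dist_spec _ _)), <- C1.
  assert (D : dist X Y * dist Q R < C).
  { rewrite <- He. apply CReal_mult_lt_compat_r; assumption. }
  setoid_replace (dist X Y * dist X Y * (dist Q R * dist Q R))
    with (dist X Y * dist Q R * (dist X Y * dist Q R)) by ring.
  apply CReal_le_lt_trans with (C * (dist X Y * dist Q R)).
  - apply CReal_mult_le_compat_r; [| apply CRealLt_asym; exact D].
    apply CReal_mult_le_0_compat; exact (proj1 (dist_spec _ _)).
  - apply CReal_mult_lt_compat_l; [exact HC | exact D].
Qed.

Lemma lies_outside_cross (X Q R : point) :
  distinct Q R -> lies_outside X (line Q R) -> 0 < cross X Q R * cross X Q R.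
Proof.
  intros HQR [d [[Hinf _] Hd]].
  pose proof (distinct_dist_sq Q R HQR) as HN.
  set (N := dist_sq Q R) in *.
  set (vx := px R - px Q). set (vy := py R - py Q).
  set (wx := px X - px Q). set (wy := py X - py Q).
  (* [t] is the parameter of [F], the foot of the perpendicular from [X]. Lagrange's identity turns
     the squared area into the squared height times [N], up to the square of the defect in [Ht]. *)
  set (t := (wx * vx + wy * vy) * CReal_inv N (inr HN)).
  assert (Ht : wx * vx + wy * vy - t * N == 0).
  { unfold t. rewrite CReal_mult_assoc, CReal_inv_l. ring. }
  set (F := mkPoint (px Q + t * vx) (py Q + t * vy)).
  assert (HF : line Q R F) by (exists t; split; apply CRealEq_refl).
  assert (E : cross X Q R * cross X Q R == dist X F * dist X F * N).
  { rewrite (proj2 (dist_spec X F)).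
    setoid_replace (cross X Q R * cross X Q R)
      with (((px X - px F) * (px X - px F) + (py X - py F) * (py X - py F)) * N
            - (wx * vx + wy * vy - t * N) * (wx * vx + wy * vy - t * N))
      by (unfold cross, N, F, wx, wy, vx, vy, dist_sq; cbn [px py]; ring).
    rewrite Ht. ring. }
  rewrite E.
  pose proof (CReal_lt_le_trans _ _ _ Hd (Hinf F HF)) as HdF.
  exact (CReal_mult_lt_0_compat _ _ (CReal_mult_lt_0_compat _ _ HdF HdF) HN).
Qed.

Lemma incidence_dec (S : pset) : linearly_discrete S ->
  forall P Q R, S P -> S Q -> S R -> distinct Q R ->
  ((cross P Q R == 0) + (0 < cross P Q R * cross P Q R))%type.
Proof.
  intros H P Q R HP HQ HR HQR. destruct (H P Q R HP HQ HR HQR).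
  - left. apply lies_on_cross; assumption.
  - right. apply lies_outside_cross; assumption.
Qed.

(** Cramer's rule: both incidences are linear equations in [P - Q], with determinant [cross Q A B]
    up to sign. *)
Lemma cross_transversal (P Q A B : point) :
  0 < cross Q A B * cross Q A B -> cross P Q A == 0 -> cross P Q B == 0 -> point_eq P Q.
Proof.
  intros H HA HB.
  assert (E : forall z, z * cross Q A B == 0 -> z == 0).
  { intros z Hz. apply CReal_mult_eq_reg_r with (cross Q A B).
    - rewrite Hz. ring.
    - destruct (CReal_mult_pos_appart_zero _ _ H); [right | left]; assumption. }
  assert (Ex : px P - px Q == 0).
  { apply E.
    setoid_replace ((px P - px Q) * cross Q A B)
      with ((px B - px Q) * cross P Q A - (px A - px Q) * cross P Q B)
      by (unfold cross; ring).
    rewrite HA, HB. ring. }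
  assert (Ey : py P - py Q == 0).
  { apply E.
    setoid_replace ((py P - py Q) * cross Q A B)
      with ((py B - py Q) * cross P Q A - (py A - py Q) * cross P Q B)
      by (unfold cross; ring).
    rewrite HA, HB. ring. }
  split.
  - setoid_replace (px P) with (px P - px Q + px Q) by ring. rewrite Ex. ring.
  - setoid_replace (py P) with (py P - py Q + py Q) by ring. rewrite Ey. ring.
Qed.

Lemma eq_dec_of_triangle (S : pset) : linearly_discrete S ->
  forall P Q A B, S P -> S Q -> S A -> S B -> 0 < cross Q A B * cross Q A B ->
  (distinct P Q + {point_eq P Q})%type.
Proof.
  intros HS P Q A B HP HQ HA HB H.
  assert (DA : distinct Q A).
  { apply dist_sq_distinct, (cross_pos_dist_sq Q A B H). }
  assert (DB : distinct Q B).
  { apply dist_sq_distinct, (cross_pos_dist_sq Q B A).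
    setoid_replace (cross Q B A * cross Q B A) with (cross Q A B * cross Q A B)
      by (unfold cross; ring). exact H. }
  destruct (incidence_dec S HS P Q A HP HQ HA DA) as [EA|NA].
  - destruct (incidence_dec S HS P Q B HP HQ HB DB) as [EB|NB].
    + right. exact (cross_transversal P Q A B H EA EB).
    + left. apply dist_sq_distinct, (cross_pos_dist_sq P Q B NB).
  - left. apply dist_sq_distinct, (cross_pos_dist_sq P Q A NA).
Qed.

Lemma linearly_discrete_eq_dec (S : pset) : linearly_discrete S -> noncollinear S ->
  forall P Q, S P -> S Q -> (distinct P Q + {point_eq P Q})%type.
Proof.
  intros HS [A [B [C [[[[[[HA HB] HC] _] _] HBC] HO]]]] P Q HP HQ.
  pose proof (lies_outside_cross A B C HBC HO) as H.
  assert (H' : 0 < (cross Q A B + (cross Q B C + cross Q C A))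
                   * (cross Q A B + (cross Q B C + cross Q C A))).
  { setoid_replace (cross Q A B + (cross Q B C + cross Q C A)) with (cross A B C)
      by (unfold cross; ring). exact H. }
  destruct (CReal_square_plus_pos _ _ H') as [K|K].
  - exact (eq_dec_of_triangle S HS P Q A B HP HQ HA HB K).
  - destruct (CReal_square_plus_pos _ _ K) as [K'|K'].
    + exact (eq_dec_of_triangle S HS P Q B C HP HQ HB HC K').
    + exact (eq_dec_of_triangle S HS P Q C A HP HQ HC HA K').
Qed.

(** * Kelly's argument *)

(* Minimality is obtained only up to double negation, hence the continuation. *)
Lemma minimum_not_not {T : Type} (D : T -> Prop) (R : T -> T -> Prop) :
  (forall x, R x x) ->
  (forall x y z, D y -> R x y -> R y z -> R x z) ->
  (forall x y, ~ R x y -> R y x) ->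
  forall l x, In x l -> D x ->
  ~ ~ (exists m, In m l /\ D m /\ forall y, In y l -> D y -> R m y).
Proof.
  intros Hrefl Htrans Htot l. induction l as [|a l IH]; intros x Hx Dx K; [destruct Hx |].
  (* Since [K] refutes a minimum of [a :: l], no element of [l] satisfies [D]: a minimum of [l],
     compared with [a], would yield one. *)
  assert (Hl : forall y, In y l -> ~ D y).
  { intros y Hy Dy. apply (IH y Hy Dy). intros [m [Hm [Dm Hmin]]]. apply K.
    exists m. split; [right; exact Hm |]. split; [exact Dm |].
    intros z [<-|Hz] Dz; [| exact (Hmin z Hz Dz)].
    apply Htot. intros Ham. apply K. exists a.
    split; [left; reflexivity |]. split; [exact Dz |].
    intros w [<-|Hw] Dw; [apply Hrefl |].
    exact (Htrans a m w Dm Ham (Hmin w Hw Dw)). }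
  destruct Hx as [<-|Hx]; [| exact (Hl x Hx Dx)].
  apply K. exists a. split; [left; reflexivity |]. split; [exact Dx |].
  intros y [<-|Hy] Dy; [apply Hrefl | destruct (Hl y Hy Dy)].
Qed.

(** Of two numbers on the same side of 0, one lies between 0 and the other. Otherwise
    [x * y < x * x] and [x * y < y * y], whose product is absurd. *)
Lemma CReal_same_sign_between (x y : CReal) :
  ~ 0 <= x * (y - x) -> ~ 0 <= y * (x - y) -> ~ 0 <= x * y.
Proof.
  intros Hx Hy H. apply Hx. intros Cx. apply Hy. intros Cy.
  assert (Lx : x * y < x * x).
  { apply (CReal_plus_lt_reg_r (- (x * x))).
    setoid_replace (x * x + - (x * x)) with 0 by ring.
    setoid_replace (x * y + - (x * x)) with (x * (y - x)) by ring. exact Cx. }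
  assert (Ly : x * y < y * y).
  { apply (CReal_plus_lt_reg_r (- (y * y))).
    setoid_replace (y * y + - (y * y)) with 0 by ring.
    setoid_replace (x * y + - (y * y)) with (y * (x - y)) by ring. exact Cy. }
  apply (CRealLt_irrefl (x * y * (x * y))).
  apply CReal_le_lt_trans with (x * y * (y * y)).
  - apply CReal_mult_le_compat_l; [exact H | apply CRealLt_asym; exact Ly].
  - setoid_replace (x * y * (x * y)) with (x * x * (y * y)) by ring.
    apply CReal_mult_lt_compat_r; [| exact Lx].
    apply CReal_le_lt_trans with (1 := H). exact Ly.
Qed.

(** Two of three points on a line lie on the same side of the foot: [(x * y) * (y * z)] has the sign
    of [x * z]. *)
Lemma CReal_three_signs (x y z : CReal) :
  ~ 0 <= x * y -> ~ 0 <= y * z -> ~ 0 <= x * z -> False.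
Proof.
  intros Hxy Hyz Hxz. apply Hxy. intros Cxy. apply Hyz. intros Cyz.
  apply Hxz. intros Cxz.
  pose proof (CReal_mult_neg_neg _ _ Cxy Cyz) as C.
  pose proof (CReal_square_nonneg y) as Y.
  assert (C' : 0 < y * y * (x * z)).
  { setoid_replace (y * y * (x * z)) with (x * y * (y * z)) by ring. exact C. }
  apply (CRealLt_irrefl 0), CReal_lt_le_trans with (1 := C').
  rewrite <- (CReal_mult_0_r (y * y)).
  apply CReal_mult_le_compat_l; [exact Y | apply CRealLt_asym; exact Cxz].
Qed.

(* [X] has abscissa [foot_coord P Q R X / dist_sq Q R] on [QR], in the unit
   [R - Q], measured from the foot of the perpendicular from [P]. *)
Definition foot_coord (P Q R X : point) : CReal :=
  (px X - px P) * (px R - px Q) + (py X - py P) * (py R - py Q).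

(** The area of [U P V] is computed from its base [UV] on [QR] and the height of [P]. *)
Lemma cross_foot_coord (P Q R U V : point) :
  cross U Q R == 0 -> cross V Q R == 0 ->
  cross U P V * dist_sq Q R
  == (foot_coord P Q R U - foot_coord P Q R V) * cross P Q R.
Proof.
  intros HU HV.
  setoid_replace (cross U P V * dist_sq Q R)
    with ((foot_coord P Q R U - foot_coord P Q R V) * (cross P Q R - cross U Q R)
          + foot_coord P Q R U * (cross U Q R - cross V Q R))
    by (unfold cross, foot_coord, dist_sq; ring).
  rewrite HU, HV. ring.
Qed.

(** Pythagoras for [P], the foot and [V], scaled by [dist_sq Q R]. *)
Lemma dist_sq_foot_coord (P Q R V : point) :
  cross V Q R == 0 ->
  dist_sq P V * dist_sq Q R
  == foot_coord P Q R V * foot_coord P Q R V + cross P Q R * cross P Q R.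
Proof.
  intros HV.
  setoid_replace (dist_sq P V * dist_sq Q R)
    with (foot_coord P Q R V * foot_coord P Q R V
          + (cross P Q R - cross V Q R) * (cross P Q R - cross V Q R))
    by (unfold cross, foot_coord, dist_sq; ring).
  rewrite HV. ring.
Qed.

Lemma foot_coord_inj (P Q R U V : point) :
  ~ dist_sq Q R == 0 -> cross U Q R == 0 -> cross V Q R == 0 ->
  foot_coord P Q R U - foot_coord P Q R V == 0 -> ~ ~ point_eq U V.
Proof.
  intros HN HU HV HUV Hne.
  apply (CReal_nonneg_pos _ (dist_sq_nonneg Q R) HN). intros Npos.
  apply Hne, dist_sq_zero, CReal_mult_eq_reg_r with (dist_sq Q R).
  - setoid_replace (dist_sq U V * dist_sq Q R)
      with ((foot_coord P Q R U - foot_coord P Q R V)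
            * (foot_coord P Q R U - foot_coord P Q R V)
            + (cross U Q R - cross V Q R) * (cross U Q R - cross V Q R))
      by (unfold cross, foot_coord, dist_sq; ring).
    rewrite HU, HV, HUV. ring.
  - right; exact Npos.
Qed.

(** The squared distance from [P] to [QR] is at most that from [P'] to [Q'R'], with denominators
    cleared so that degenerate pairs need no division. *)
Definition farther_triple (t s : point * point * point) : Prop :=
  let '(P, Q, R) := t in let '(P', Q', R') := s in
  cross P Q R * cross P Q R * dist_sq Q' R' <= cross P' Q' R' * cross P' Q' R' * dist_sq Q R.

Lemma cross_nonzero_dist_sq (P Q R : point) : ~ cross P Q R == 0 -> ~ dist_sq Q R == 0.
Proof.
  intros H HN. apply H. destruct (dist_sq_zero Q R HN) as [Ex Ey].
  unfold cross. rewrite Ex, Ey. ring.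
Qed.

Lemma farther_triple_refl (t : point * point * point) : farther_triple t t.
Proof. destruct t as [[P Q] R]. apply CRealLe_refl. Qed.

Lemma farther_triple_total (t s : point * point * point) :
  ~ farther_triple t s -> farther_triple s t.
Proof.
  destruct t as [[P Q] R], s as [[P' Q'] R']. cbn. intros H C.
  apply H. apply CRealLt_asym. exact C.
Qed.

Definition noncollinear_triple (t : point * point * point) : Prop :=
  let '(P, Q, R) := t in ~ cross P Q R == 0.

(** The middle triple is noncollinear because its cleared denominator has to be cancelled. *)
Lemma farther_triple_trans (t s r : point * point * point) : noncollinear_triple s ->
  farther_triple t s -> farther_triple s r -> farther_triple t r.
Proof.
  destruct t as [[P Q] R], s as [[P' Q'] R'], r as [[P'' Q''] R'']. cbn.
  intros D Hts Hsr C.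
  apply (CReal_nonneg_pos _ (dist_sq_nonneg Q' R') (cross_nonzero_dist_sq _ _ _ D)).
  intros N. revert C. change (cross P Q R * cross P Q R * dist_sq Q'' R''
    <= cross P'' Q'' R'' * cross P'' Q'' R'' * dist_sq Q R).
  apply (CReal_mult_le_reg_r (dist_sq Q' R')); [exact N |].
  apply CReal_le_trans with (cross P' Q' R' * cross P' Q' R' * dist_sq Q R * dist_sq Q'' R'').
  - setoid_replace (cross P Q R * cross P Q R * dist_sq Q'' R'' * dist_sq Q' R')
      with (cross P Q R * cross P Q R * dist_sq Q' R' * dist_sq Q'' R'') by ring.
    apply CReal_mult_le_compat_r; [apply dist_sq_nonneg | exact Hts].
  - setoid_replace (cross P' Q' R' * cross P' Q' R' * dist_sq Q R * dist_sq Q'' R'')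
      with (cross P' Q' R' * cross P' Q' R' * dist_sq Q'' R'' * dist_sq Q R) by ring.
    setoid_replace (cross P'' Q'' R'' * cross P'' Q'' R'' * dist_sq Q R * dist_sq Q' R')
      with (cross P'' Q'' R'' * cross P'' Q'' R'' * dist_sq Q' R' * dist_sq Q R) by ring.
    apply CReal_mult_le_compat_r; [apply dist_sq_nonneg | exact Hsr].
Qed.

(* If [U] lies between the foot of the perpendicular from [P] to [QR] and [V],
   then [U] is nearer to [PV] than [P] is to [QR]. *)
Lemma kelly_step (P Q R U V : point) :
  ~ cross P Q R == 0 -> cross U Q R == 0 -> cross V Q R == 0 ->
  farther_triple (P, Q, R) (U, P, V) ->
  ~ 0 <= foot_coord P Q R U * (foot_coord P Q R V - foot_coord P Q R U).
Proof.
  intros Hh HU HV Hmin Hb.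
  change (cross P Q R * cross P Q R * dist_sq P V
          <= cross U P V * cross U P V * dist_sq Q R) in Hmin.
  pose proof (dist_sq_foot_coord P Q R V HV) as EV.
  pose proof (cross_foot_coord P Q R U V HU HV) as EU.
  pose proof (dist_sq_nonneg Q R) as HN.
  revert Hh Hmin Hb EV EU HN.
  generalize (cross P Q R) (dist_sq Q R) (foot_coord P Q R U) (foot_coord P Q R V)
    (dist_sq P V) (cross U P V).
  intros h N u v d c Hh Hmin Hb EV EU HN.
  apply (CReal_nonneg_pos (h * h) (CReal_square_nonneg h)).
  { intros E. apply Hh, CReal_square_zero. intros C. rewrite E in C.
    exact (CRealLt_irrefl 0 C). }
  intros Hpos.
  (* This is minimality times [N], rewritten by [EV] and [EU]. Cancelling [h * h] and using that
     [u * (v - u)] is nonnegative gives [h * h <= 0]. *)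
  assert (L : (v * v + h * h) * (h * h) <= (u - v) * (u - v) * (h * h)).
  { setoid_replace ((u - v) * (u - v) * (h * h)) with ((u - v) * h * ((u - v) * h)) by ring.
    rewrite <- EV, <- EU.
    setoid_replace (d * N * (h * h)) with (h * h * d * N) by ring.
    setoid_replace (c * N * (c * N)) with (c * c * N * N) by ring.
    apply CReal_mult_le_compat_r; [exact HN | exact Hmin]. }
  apply CReal_mult_le_reg_r in L; [| exact Hpos].
  apply (proj1 (CReal_le_0_sub _ _)) in L.
  apply (CRealLt_irrefl 0), CReal_lt_le_trans with (1 := Hpos).
  apply (proj2 (CReal_le_0_sub _ _)).
  setoid_replace (0 - h * h)
    with ((u - v) * (u - v) - (v * v + h * h) + (u * (v - u) + u * (v - u) + u * u))
    by ring.
  apply CReal_plus_nonneg; [exact L |].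
  apply CReal_plus_nonneg; [apply CReal_plus_nonneg; exact Hb | apply CReal_square_nonneg].
Qed.

(** The conclusion is an equality, so a nearest noncollinear triple may be used although it exists
    only up to double negation. Its line carries three different points, any two of which would be
    on opposite sides of the foot. *)
Lemma no_sylvester_configuration (L : list point) :
  (forall A B, In A L -> In B L -> ~ point_eq A B ->
     exists C, In C L /\ cross C A B == 0 /\ ~ point_eq C A /\ ~ point_eq C B) ->
  forall A B C, In A L -> In B L -> In C L -> cross A B C == 0.
Proof.
  intros Hthird A B C HA HB HC. apply CReal_square_zero. intros Hpos.
  set (T := list_prod (list_prod L L) L).
  assert (HT : forall X Y Z, In X L -> In Y L -> In Z L -> In (X, Y, Z) T).
  { intros X Y Z HX HY HZ. repeat apply in_prod; assumption. }
  apply (minimum_not_not noncollinear_triple farther_triple farther_triple_refl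
           farther_triple_trans farther_triple_total T (A, B, C) (HT A B C HA HB HC)).
  { cbn. intros E. rewrite E in Hpos. apply (CRealLt_irrefl 0).
    eapply CRealLt_proper_r; [| exact Hpos]. ring. }
  intros [[[P Q] R] [Hm [Hh Hmin]]]. cbn in Hh.
  apply in_prod_iff in Hm as [Hm HR]. apply in_prod_iff in Hm as [HP HQ].
  pose proof (cross_nonzero_dist_sq P Q R Hh) as HN.
  assert (HQR : ~ point_eq Q R).
  { intros [Ex Ey]. apply HN. unfold dist_sq. rewrite Ex, Ey. ring. }
  destruct (Hthird Q R HQ HR HQR) as [X [HX [EX [HXQ HXR]]]].
  assert (EQ : cross Q Q R == 0) by (unfold cross; ring).
  assert (ER : cross R Q R == 0) by (unfold cross; ring).
  (* Minimality can be applied to [(U, P, V)] only if it is noncollinear; zero area would give [U]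
     and [V] the same coordinate, against [Hne]. *)
  assert (K : forall U V, In U L -> In V L -> cross U Q R == 0 -> cross V Q R == 0 ->
     ~ point_eq U V ->
     ~ 0 <= foot_coord P Q R U * (foot_coord P Q R V - foot_coord P Q R U)).
  { intros U V HU HV EU EV Hne. apply kelly_step; [assumption .. |].
    apply Hmin; [apply HT; assumption |]. cbn. intros E.
    apply (foot_coord_inj P Q R U V HN EU EV); [| exact Hne].
    apply CReal_square_zero. intros F.
    apply Hh.
    apply CReal_mult_eq_reg_l with (foot_coord P Q R U - foot_coord P Q R V).
    - destruct (CReal_mult_pos_appart_zero _ _ F); [right | left]; assumption.
    - rewrite <- cross_foot_coord by assumption. rewrite E. ring. }
  assert (K2 : forall U V, In U L -> In V L -> cross U Q R == 0 -> cross V Q R == 0 ->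
     ~ point_eq U V -> ~ 0 <= foot_coord P Q R U * foot_coord P Q R V).
  { intros U V HU HV EU EV Hne. apply CReal_same_sign_between; apply K; try assumption.
    intros E. exact (Hne (point_eq_sym _ _ E)). }
  apply (CReal_three_signs (foot_coord P Q R X) (foot_coord P Q R Q) (foot_coord P Q R R));
    apply K2; assumption.
Qed.

(** * Finite search *)

Lemma bounded_search (n : nat) (P Q : nat -> Type) :
  (forall i, (i < n)%nat -> P i + Q i) ->
  { i : nat & ((i < n)%nat * P i)%type } + (forall i, (i < n)%nat -> Q i).
Proof.
  induction n as [|n IH]; intros H.
  - right. intros i Hi. exfalso. lia.
  - destruct (H n ltac:(lia)) as [p|q].
    + left. exists n. split; [lia | exact p].
    + destruct IH as [[i [Hi p]]|all].
      * intros i Hi. apply H. lia.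
      * left. exists i. split; [lia | exact p].
      * right. intros i Hi. destruct (PeanoNat.Nat.eq_dec i n) as [->|Hne]; [exact q |].
        apply all. lia.
Qed.

Definition ordinary_pair (n : nat) (a : nat -> point) (A B : point) : Type :=
  (distinct A B *
   (forall k, (k < n)%nat ->
      (0 < cross (a k) A B * cross (a k) A B)
      + ({point_eq (a k) A} + {point_eq (a k) B})))%type.

(** The inequalities are mere negations, as the refutation of a failed search asks for no more. *)
Definition third_point (n : nat) (a : nat -> point) (A B : point) : Type :=
  { k : nat & ((k < n)%nat *
     (cross (a k) A B == 0 /\ ~ point_eq (a k) A /\ ~ point_eq (a k) B))%type }.

(** Equality of points and incidence with a line through two distinct points are decidable on [S],
    so each listed point can be classified. *)
Lemma ordinary_pair_dec (S : pset) (n : nat) (a : nat -> point) :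
  linearly_discrete S -> noncollinear S -> (forall i, (i < n)%nat -> S (a i)) ->
  forall A B, S A -> S B ->
  ordinary_pair n a A B + (point_eq A B + third_point n a A B).
Proof.
  intros HS Hnc Ha A B HA HB.
  destruct (linearly_discrete_eq_dec S HS Hnc A B HA HB) as [HAB|E];
    [| right; left; exact E].
  destruct (bounded_search n
    (fun k => cross (a k) A B == 0 /\ ~ point_eq (a k) A /\ ~ point_eq (a k) B)
    (fun k => (0 < cross (a k) A B * cross (a k) A B)
              + ({point_eq (a k) A} + {point_eq (a k) B}))%type) as [third|ord].
  - intros k Hk. pose proof (Ha k Hk) as Hak.
    destruct (incidence_dec S HS (a k) A B Hak HA HB HAB) as [on|out];
      [| right; left; exact out].
    destruct (linearly_discrete_eq_dec S HS Hnc (a k) A Hak HA) as [NA|EA];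
      [| right; right; left; exact EA].
    destruct (linearly_discrete_eq_dec S HS Hnc (a k) B Hak HB) as [NB|EB];
      [| right; right; right; exact EB].
    left. split; [exact on |]. split; apply distinct_not_eq; assumption.
  - right; right. exact third.
  - left. split; [exact HAB | exact ord].
Qed.

Theorem mainTheorem2 (S : pset) :
  finite S -> linearly_discrete S -> noncollinear S ->
  { A : point & { B : point &
    (S A * S B * distinct A B *
     (forall X : point, S X -> lies_on X (line A B) ->
        {point_eq X A} + {point_eq X B}))%type } }.
Proof.
  intros [n [a [_ Hfin]]] HS Hnc.
  assert (Ha : forall i, (i < n)%nat -> S (a i)).
  { intros i Hi. apply (Hfin (a i)). exists i. split; [exact Hi |].
    apply point_eq_refl. }
  (* A nested search over all pairs of indices, either returning an ordinary pair or giving a third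
     point for every pair of unequal points. *)
  destruct (bounded_search n
    (fun i => { j : nat & ((j < n)%nat * ordinary_pair n a (a i) (a j))%type })
    (fun i => forall j, (j < n)%nat -> (point_eq (a i) (a j) + third_point n a (a i) (a j))%type))
    as [[i [Hi [j [Hj [Hij Hord]]]]]|none].
  - intros i Hi. apply bounded_search. intros j Hj.
    apply (ordinary_pair_dec S n a HS Hnc Ha); apply Ha; assumption.
  - exists (a i), (a j). split; [split; [split |] |]; [apply Ha, Hi | apply Ha, Hj | exact Hij |].
    intros X HX Hon. destruct (fst (Hfin X) HX) as [k [Hk Ek]].
    destruct (Hord k Hk) as [out|[E|E]].
    + exfalso. apply (CRealLt_irrefl 0).
      pose proof (lies_on_cross X (a i) (a j) Hij Hon) as Hc.
      rewrite (cross_ext _ _ _ _ _ _ Ek (point_eq_refl _) (point_eq_refl _)) in Hc.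
      rewrite Hc in out. eapply CRealLt_proper_r; [| exact out]. ring.
    + left. exact (point_eq_trans _ _ _ Ek E).
    + right. exact (point_eq_trans _ _ _ Ek E).
  (* If the search fails, Kelly's argument makes all listed points collinear, against the
     noncollinear triple [P], [Q], [R]. *)
  - exfalso. destruct Hnc as [P [Q [R [[[[[[HP HQ] HR] _] _] HQR] HO]]]].
    pose proof (lies_outside_cross P Q R HQR HO) as Hc.
    destruct (fst (Hfin P) HP) as [p [Hp Ep]].
    destruct (fst (Hfin Q) HQ) as [q [Hq Eq]].
    destruct (fst (Hfin R) HR) as [r [Hr Er]].
    assert (HL : forall k, (k < n)%nat -> In (a k) (map a (seq 0 n))).
    { intros k Hk. apply in_map, in_seq. lia. }
    assert (E : cross P Q R == 0).
    { rewrite (cross_ext _ _ _ _ _ _ Ep Eq Er).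
      apply (no_sylvester_configuration (map a (seq 0 n))); try (apply HL; assumption).
      intros A B HA HB HAB.
      apply in_map_iff in HA as [i [<- Hi]]. apply in_map_iff in HB as [j [<- Hj]].
      apply in_seq in Hi. apply in_seq in Hj.
      destruct (none i ltac:(lia) j ltac:(lia)) as [E|[k [Hk H]]].
      - destruct (HAB E).
      - exists (a k). split; [apply HL, Hk | exact H]. }
    rewrite E in Hc. apply (CRealLt_irrefl 0).
    eapply CRealLt_proper_r; [| exact Hc]. ring.
Qed.
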